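(* $r_{\mu}(C_{n_1})=r_{\mu}(C_{n_2})$ if and only if $n_1=6$ and $n_2=7$.
   Context: Graphs are simple and undirected. For a graph $G=(V,E)$ and $X\subseteq V$, two vertices $u,v\in V$ are $X$-visible if there exists a shortest path $P$ from $u$ to $v$ in $G$ with $V(P)\cap X\subseteq\{u,v\}$. A set $X\subseteq V$ is a mutual-visibility set of $G$ if every pair of vertices in $X$ is $X$-visible. The mutual-visibility number $\mu(G)$ is the cardinality of a largest mutual-visibility set of $G$, and $r_{\mu}(G)$ is the number of mutual-visibility sets of $G$ of cardinality $\mu(G)$. $C_n$ denotes the cycle graph of order $n\ge 3$; $C_{n_1}$ and $C_{n_2}$ are the cycle graphs of orders $n_1$ and $n_2$.
   Formalization: The orders are assumed to satisfy n_1 < n_2; without this the equivalence fails, since equality also holds whenever n_1 = n_2 and for n_1 = 7, n_2 = 6. *)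

(* Defs.v *)
From mathcomp Require Import all_boot.

Set Implicit Arguments.
Unset Strict Implicit.
Unset Printing Implicit Defensive.

Section MutualVisibility.

(* A simple graph is a symmetric irreflexive adjacency relation on a finType. *)
Variables (T : finType) (e : rel T).

(* The path visits u :: p; it has no repeated vertex, and its length is size p. *)
Definition is_path (u v : T) (p : seq T) : bool :=
  [&& path e u p, last u p == v & uniq (u :: p)].

(* Bounded sequences make the quantifier finite; the bound loses nothing, since
   is_path u v q forces size q < #|T|. *)
Definition is_shortest_path (u v : T) (p : seq T) : bool :=
  is_path u v p &&
  [forall q : #|T|.-bseq T, is_path u v q ==> (size p <= size q)].

Definition visible (X : {set T}) (u v : T) : bool :=
  [exists p : #|T|.-bseq T,
     is_shortest_path u v p &&
     ([set w in u :: p] :&: X \subset [set u; v])].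

Definition mutual_visibility_set (X : {set T}) : bool :=
  [forall u in X, forall v in X, visible X u v].

Definition mu : nat := \max_(X : {set T} | mutual_visibility_set X) #|X|.

Definition r_mu : nat :=
  #|[set X : {set T} | mutual_visibility_set X & #|X| == mu]|.

End MutualVisibility.

(* ordS is the cyclic successor on 'I_n, so this is C_n for 2 < n. *)
Definition cycle_graph (n : nat) : rel 'I_n :=
  [rel i j | (j == ordS i) || (i == ordS j)].

Arguments cycle_graph n : clear implicits.

Lemma cycle_graph_sym n : symmetric (cycle_graph n).
Proof. by move=> i j; rewrite /cycle_graph /= orbC. Qed.

Lemma cycle_graph_irr n : 1 < n -> irreflexive (cycle_graph n).
Proof.
move=> n_gt1 i; rewrite /cycle_graph /= orbb; apply/negbTE/eqP => /(congr1 val) /=.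
have := ltn_ord i; rewrite leq_eqVlt => /orP[/eqP in_eq|lt_in].
  by rewrite in_eq modnn => i0; rewrite -in_eq i0 in n_gt1.
by rewrite modn_small // => /n_Sn.
Qed.

(* Main.v *)
Require Import Defs.
From mathcomp Require Import all_boot zify.

Set Implicit Arguments.
Unset Strict Implicit.
Unset Printing Implicit Defensive.

(** In C_n write d(u, v) for the number of steps from u to v in the positive
direction, so that d(u, v) + d(v, u) = n for u <> v. Any path from u to v
contains one of the two closed arcs between u and v: were a vertex of each arc
missing, the path could not leave the component of u in the cycle cut at those
two vertices ([path_covers_arc]). Hence the shortest paths are the arcs with at
most n / 2 edges, and u, v are X-visible exactly when one of the two arcs has
at most n / 2 edges and meets X only at its ends ([visible_cycleP]).

Among four vertices, the first and the third in cyclic order are separated on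
both sides by the other two, so mutual-visibility sets have at most 3 elements.
Three vertices fail exactly when one of the three gaps between them exceeds
n / 2. With k = floor((n - 1) / 2), the largest number of steps that is less
than n / 2, this says that the vertices lie in an arc of k steps; the first of
them on that arc, their pole, is then determined by the set ([pole_uniq]), and
there are 'C(k, 2) choices for the other two. For n >= 3 some triple remains,
and

  r_mu(C_n) = 'C(n, 3) - n * 'C(k, 2),

that is, 6 r_mu(C_n) = k (k + 1) (2k + 1) for n = 2k + 1, and
6 r_mu(C_n) = k (k + 1) (2k + 10) for n = 2k + 2 ([r_mu_cycle]).

Both formulas increase with k. The even value for k exceeds the odd value for
k, and is below the odd value for k + 2, so an equality can only occur between
n1 = 2j + 2 and n2 = 2j + 3; there it reads
j (2j + 10) = (j + 2) (2j + 3), whose only solution is j = 2. *)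

(** * Visibility in a finite graph *)

Section Visibility.

Variables (T : finType) (e : rel T).

Lemma size_is_path u v p : is_path e u v p -> size p <= #|T|.
Proof.
by case/and3P=> _ _ /card_uniqP /= sz; apply: ltnW; rewrite -sz max_card.
Qed.

(** Unbounded form of the definition: the bound on the length of paths in
[visible] is harmless because paths have no repeated vertex. *)
Lemma visibleP (X : {set T}) u v :
  reflect (exists2 p, is_path e u v p &
             (forall q, is_path e u v q -> size p <= size q) /\
             (forall w, w \in u :: p -> w \in X -> w = u \/ w = v))
          (visible e X u v).
Proof.
apply: (iffP existsP) => [[p] | [p pP [minp pX]]].
  case/andP=> /andP[pP /forallP minp] /subsetP pX.
  exists (bseqval p) => //; split=> [q qP | w wp wX].
    exact: (implyP (minp (Bseq (size_is_path qP)))).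
  by apply/set2P/pX; rewrite !inE in wp *; rewrite wp.
exists (Bseq (size_is_path pP)); rewrite /is_shortest_path pP /=.
apply/andP; split; first by apply/forallP=> q; apply/implyP/minp.
by apply/subsetP=> w /setIP[]; rewrite inE => wp wX; apply/set2P/pX.
Qed.

Lemma is_path_rev u v p : symmetric e ->
  is_path e u v p -> is_path e v u (rev (belast u p)).
Proof.
move=> sym_e /and3P[ep /eqP <- Up]; apply/and3P; split.
- by rewrite rev_path; apply: sub_path ep => x y /=; rewrite sym_e.
- by case: p {ep Up} => //= x p; rewrite rev_cons last_rcons.
- by rewrite -rev_rcons -lastI rev_uniq.
Qed.

Lemma visible_sym X u v : symmetric e -> visible e X u v -> visible e X v u.
Proof.
move=> sym_e /visibleP[p pP [minp pX]].
apply/visibleP; exists (rev (belast u p)); first exact: is_path_rev.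
split=> [q qP | w].
  by have:= minp _ (is_path_rev sym_e qP); rewrite !size_rev !size_belast.
case/and3P: pP => _ /eqP last_p _.
rewrite -{1}last_p -rev_rcons -lastI mem_rev => wp wX.
by case: (pX w wp wX); [right | left].
Qed.

Lemma visible_refl X u : visible e X u u.
Proof.
apply/visibleP; exists [::]; first by rewrite /is_path /= eqxx.
by split=> // w; rewrite inE => /eqP ->; left.
Qed.

End Visibility.

(** * Positive distance and arcs of a cycle *)

Section Cycle.

Variable n : nat.
Implicit Types (u v w x y : 'I_n) (X : {set 'I_n}).

Definition fdist u v := if u <= v then v - u else n + v - u.

(** The truncated subtractions and the case split of [fdist] in a form that
linear arithmetic can use. *)
Lemma fdistP u v :
  u < n /\ v < n /\
  (u <= v /\ fdist u v + u = v \/ v < u /\ fdist u v + u = n + v).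
Proof.
have lt_un := ltn_ord u; do 2!split=> //; rewrite /fdist.
by case: leqP => le_uv; [left | right]; rewrite subnK // ltnW ?ltn_addr.
Qed.

Lemma ordSP u :
  u < n /\ (u.+1 < n /\ ordS u = u.+1 :> nat \/ u.+1 = n /\ ordS u = 0 :> nat).
Proof.
split=> //=; have := ltn_ord u; rewrite leq_eqVlt => /orP[/eqP eq_n | lt_n].
  by right; rewrite eq_n modnn.
by left; rewrite modn_small.
Qed.

Lemma ord_eqE u v : (u == v) = (u == v :> nat).
Proof. by []. Qed.

(** A positional fact about finitely many vertices of the cycle becomes linear
arithmetic on their indices once each distance and each successor is replaced
by its description by cases. *)
Local Ltac cycle_lia :=
  rewrite ?ord_eqE;
  repeat match goal with
  | |- context [fdist ?u ?v] =>
      move: (fdistP u v); generalize (fdist u v); move=> ?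
  end;
  repeat match goal with
  | |- context [nat_of_ord (ordS ?u)] =>
      move: (ordSP u); generalize (nat_of_ord (ordS u)); move=> ?
  end;
  lia.

Lemma fdistC u v : u != v -> fdist u v + fdist v u = n.
Proof. cycle_lia. Qed.

Lemma fdist_lt u v : fdist u v < n.
Proof. cycle_lia. Qed.

Lemma fdist_inj u : injective (fdist u).
Proof. move=> v w eq_d; apply/ord_inj; move: eq_d; cycle_lia. Qed.

Lemma fdist0 u v : (fdist u v == 0) = (u == v).
Proof. cycle_lia. Qed.

Lemma fdist_iter u m : m < n -> fdist u (iter m (@ordS n) u) = m.
Proof.
elim: m => [|m IHm] lt_mn; first by apply/eqP; rewrite fdist0.
move: (IHm (ltnW lt_mn)); rewrite iterS; move: lt_mn; cycle_lia.
Qed.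

Lemma map_fdist_traject u m : m <= n ->
  map (fdist u) (traject (@ordS n) u m) = iota 0 m.
Proof.
move=> le_mn; apply: (@eq_from_nth _ 0) => [|i].
  by rewrite size_map size_traject size_iota.
rewrite size_map size_traject => lt_im.
rewrite (nth_map u) ?size_traject // nth_traject // nth_iota //.
by rewrite fdist_iter // (leq_trans lt_im).
Qed.

Definition forward_arc u m := [set w | fdist u w < m].

Lemma mem_traject u m w : m <= n ->
  (w \in traject (@ordS n) u m) = (w \in forward_arc u m).
Proof.
move=> le_mn; rewrite -(mem_map (@fdist_inj u)) map_fdist_traject //.
by rewrite mem_iota inE.
Qed.

Lemma traject_uniq u m : m <= n -> uniq (traject (@ordS n) u m).
Proof.
move=> le_mn.
by rewrite -(map_inj_uniq (@fdist_inj u)) map_fdist_traject ?iota_uniq.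
Qed.

Lemma card_arc u m : m <= n -> #|forward_arc u m| = m.
Proof.
move=> le_mn; rewrite -[RHS](size_traject (@ordS n) u m).
rewrite -(card_uniqP (traject_uniq u le_mn)).
by apply: eq_card => w; rewrite mem_traject.
Qed.

(** * Shortest paths of a cycle *)

Notation C := (cycle_graph n).

Lemma arc_is_path u v : is_path C u v (traject (@ordS n) (ordS u) (fdist u v)).
Proof.
have lt_dn := fdist_lt u v.
apply/and3P; split.
- by apply: sub_path (fpath_traject _ _ _) => x y /eqP <-; apply/orP; left.
- by apply/eqP/(@fdist_inj u); rewrite last_traject fdist_iter.
- by rewrite -trajectS traject_uniq.
Qed.

(** Cutting the cycle at w and w' disconnects it: a path that starts strictly
between w' and w, in the positive direction, and avoids both stays there. *)
Lemma path_stays u w w' p : path C u p -> w \notin u :: p -> w' \notin u :: p ->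
  fdist w' u < fdist w' w -> fdist w' (last u p) < fdist w' w.
Proof.
elim: p u => [|y p IHp] u //= /andP[Cuy Cp]; rewrite !(inE, negb_or).
move=> /and3P[wu wy wp] /and3P[w'u w'y w'p] lt_uw.
apply: IHp => //; rewrite ?inE ?negb_or ?wy ?w'y //.
by case/orP: Cuy => /=; move: wu wy w'u w'y lt_uw; cycle_lia.
Qed.

(** If the path missed a vertex w of the first arc and a vertex w' of the
second one, then going around from w' one would meet u before w and v after w,
against [path_stays]. *)
Lemma path_covers_arc u v p : is_path C u v p ->
  {subset forward_arc u (fdist u v).+1 <= u :: p} \/
  {subset forward_arc v (fdist v u).+1 <= u :: p}.
Proof.
case/and3P=> Cp /eqP last_p _.
have up : u \in u :: p by rewrite mem_head.
have vp : v \in u :: p by rewrite -last_p mem_last.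
case: (boolP [forall w in forward_arc u (fdist u v).+1, w \in u :: p]).
  by move/forall_inP; left.
rewrite negb_forall_in => /exists_inP[w arc_w w_p]; right=> w' arc_w'.
apply: contraT => w'_p.
have := path_stays Cp w_p w'_p; rewrite last_p.
have ne x y : x \in u :: p -> y \notin u :: p -> x != y.
  by move=> xp; apply: contraNneq => <-.
move: (ne _ _ up w_p) (ne _ _ up w'_p) (ne _ _ vp w_p) (ne _ _ vp w'_p).
by move: arc_w arc_w'; rewrite !inE; cycle_lia.
Qed.

(** The arc that the path covers also bounds its length from below. *)
Lemma path_size_ge u v p : is_path C u v p ->
  {subset forward_arc u (fdist u v).+1 <= u :: p} /\ fdist u v <= size p \/
  {subset forward_arc v (fdist v u).+1 <= u :: p} /\ fdist v u <= size p.
Proof.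
have sz x y : {subset forward_arc x (fdist x y).+1 <= u :: p} ->
    fdist x y <= size p.
  move=> sub; rewrite -ltnS -(@card_arc x (fdist x y).+1) ?fdist_lt //.
  apply: leq_trans (subset_leq_card (introT subsetP sub)) _.
  exact: leq_trans (card_size _) _.
by case/path_covers_arc=> sub; [left | right]; split=> //; apply: sz.
Qed.

Definition clear_arc X u v :=
  fdist u v <= fdist v u /\
  forall w, w \in X -> fdist u w <= fdist u v -> w = u \/ w = v.

(** The path along the shorter arc is shortest because every path covers an
arc. Conversely a shortest path covers one of the arcs and is no longer than
either, so the arc that it covers is the shorter one. *)
Lemma visible_cycleP X u v :
  visible C X u v <-> clear_arc X u v \/ clear_arc X v u.
Proof.
split=> [/visibleP[p pP [minp pX]]|].
  have le_puv : size p <= fdist u v.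
    by rewrite -(size_traject (@ordS n) (ordS u) (fdist u v)) minp ?arc_is_path.
  have le_pvu : size p <= fdist v u.
    have := minp _ (is_path_rev (@cycle_graph_sym n) (arc_is_path v u)).
    by rewrite size_rev size_belast size_traject.
  case: (path_size_ge pP) => -[sub le_p]; [left | right]; split.
  - exact: leq_trans le_pvu.
  - by move=> w wX le_w; apply: pX wX; apply: sub; rewrite inE.
  - exact: leq_trans le_puv.
  - by move=> w wX le_w; apply/or_comm; apply: pX wX; apply: sub; rewrite inE.
wlog suff clearP : u v / clear_arc X u v -> visible C X u v.
  by case=> /clearP // /(visible_sym (@cycle_graph_sym n)).
move=> [le_d clearX]; apply/visibleP.
exists (traject (@ordS n) (ordS u) (fdist u v)); first exact: arc_is_path.
split=> [q qP | w].
  rewrite size_traject; case: (path_size_ge qP) => -[_] //.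
  exact: leq_trans.
by rewrite -trajectS mem_traject ?fdist_lt // inE => le_w wX; apply: clearX.
Qed.

(** * Mutual-visibility sets of a cycle *)

Let k := n.-1./2.

(** The arc of k steps, hence k + 1 vertices, that starts at x contains X. Since
2k < n, this leaves a gap of more than n / 2 steps just before x. *)
Definition pole X x := (x \in X) && (X \subset forward_arc x k.+1).

Lemma half_fdist u v : (fdist u v <= k) = (u == v) || (fdist u v < fdist v u).
Proof. by rewrite /k; cycle_lia. Qed.

(** Two poles x and y would give d(x, y) < d(y, x) and d(y, x) < d(x, y). *)
Lemma pole_uniq X x y : pole X x -> pole X y -> x = y.
Proof.
move=> /andP[xX /subsetP subx] /andP[yX /subsetP suby]; apply/eqP.
move: (subx _ yX) (suby _ xX); rewrite !inE !ltnS !half_fdist (eq_sym y).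
by case: eqP => //= _ ltxy /(ltn_trans ltxy); rewrite ltnn.
Qed.

(** Here y and w block the two arcs between u and v. *)
Lemma mutual_visible_separated X u v y w : mutual_visibility_set C X ->
  u \in X -> v \in X -> y \in X -> w \in X ->
  0 < fdist u y < fdist u v -> fdist u v < fdist u w -> False.
Proof.
move=> /forall_inP mvX uX vX yX wX lt_y lt_w.
have/forall_inP/(_ v vX)/visible_cycleP := mvX u uX.
case=> -[_ clearX].
  case: (clearX y yX) => [|eq_y|eq_y]; move: lt_y lt_w; rewrite ?eq_y;
    cycle_lia.
case: (clearX w wX) => [|eq_w|eq_w]; move: lt_y lt_w; rewrite ?eq_w;
  cycle_lia.
Qed.

(** Order three further vertices of X by their distance from a vertex a; the
middle one is then separated from a by the other two. *)
Lemma card_mutual_visible X : mutual_visibility_set C X -> #|X| <= 3.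
Proof.
move=> mvX; rewrite leqNgt; apply/negP=> X_gt3.
have /card_gt0P[a aX] : 0 < #|X| by apply: leq_trans X_gt3.
move: X_gt3; rewrite (cardsD1 a) aX add1n ltnS.
case/card_gt2P=> x [y [z [[]]]]; rewrite !inE.
move=> /andP[xa xX] /andP[ya yX] /andP[za zX] [xy yz zx].
have sep b c d : b != a -> b \in X -> c \in X -> d \in X ->
    fdist a b < fdist a c -> fdist a c < fdist a d -> False.
  move=> ba bX cX dX lt_bc; apply: (mutual_visible_separated mvX aX cX bX dX).
  by rewrite lt_bc lt0n fdist0 eq_sym ba.
move: xy yz zx; rewrite -!(inj_eq (@fdist_inj a)) !neq_ltn.
move=> /orP[xy|yx] /orP[yz|zy] /orP[zx|xz].
all: by [apply: (sep x y z) | apply: (sep x z y) | apply: (sep y x z)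
        | apply: (sep y z x) | apply: (sep z x y) | apply: (sep z y x)].
Qed.

(** From the pole x, take two further vertices y and z of X, with y the nearer
one: the arc from x to z is the strictly shorter one, and it contains y. *)
Lemma pole_not_mutual_visible X x :
  2 < #|X| -> pole X x -> ~~ mutual_visibility_set C X.
Proof.
move=> X_gt2 /andP[xX /subsetP subX]; apply/negP=> /forall_inP mvX.
move: X_gt2; rewrite (cardsD1 x) xX add1n ltnS => /card_gt1P[y [z []]].
wlog lt_yz : y z / fdist x y < fdist x z => [Hw yX zX ne_yz|].
  have := ne_yz; rewrite -(inj_eq (@fdist_inj x)) neq_ltn.
  by case/orP => /Hw; apply; rewrite // eq_sym.
rewrite !inE => /andP[yx yX] /andP[zx zX] _.
have/forall_inP/(_ z zX)/visible_cycleP := mvX x xX.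
have := subX z zX; rewrite inE ltnS half_fdist eq_sym (negbTE zx) /=.
move=> lt_xz [[_ clearX] | [le_zx _]]; last by rewrite leqNgt lt_xz in le_zx.
by case: (clearX y yX (ltnW lt_yz)) => eq_y;
  rewrite eq_y ?eqxx ?ltnn in yx lt_yz.
Qed.

(** For u, v in X let z be the third vertex, and suppose that the arc from u to
v is the shorter one. If z is off this arc, the arc shows visibility. If z is on
it and the arc is strictly shorter, u is a pole. The remaining case is that of
antipodal u and v, where the opposite arc works. *)
Lemma mutual_visible_of_no_pole X :
  #|X| = 3 -> (forall x, ~~ pole X x) -> mutual_visibility_set C X.
Proof.
move=> X3 no_pole; apply/forall_inP=> u uX; apply/forall_inP=> v vX.
have [<- | ne_uv] := eqVneq u v; first exact: visible_refl.
have [z [zu zv] defX] : exists2 z, z != u /\ z != v & X = [set u; v; z].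
  have : #|X :\ u :\ v| = 1.
    by move: X3; rewrite (cardsD1 u) uX (cardsD1 v) !inE vX eq_sym ne_uv => -[].
  move/eqP/cards1P=> [z defz].
  have: z \in X :\ u :\ v by rewrite defz set11.
  rewrite !inE => /and3P[zv zu zX]; exists z => //.
  apply/setP=> w; move/setP/(_ w): defz; rewrite !inE => <-.
  by case: eqVneq => [-> | _]; case: eqVneq => [-> | _].
apply/visible_cycleP.
have uvn := fdistC ne_uv.
wlog le_d : u v uX vX ne_uv zu zv defX uvn / fdist u v <= fdist v u => [Hw|].
  case: (leqP (fdist u v) (fdist v u)) => [|/ltnW] le_d; first exact: Hw.
  apply/or_comm; apply: Hw; rewrite // 1?eq_sym // 1?addnC //.
  by rewrite defX (setUC [set u]).
case: (ltnP (fdist u v) (fdist u z)) => le_z.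
  left; split=> // w; rewrite defX !inE -orbA => /or3P[] /eqP ->;
    [by left | by right |].
  by rewrite leqNgt le_z.
have lt_z : fdist u z < fdist u v.
  by rewrite ltn_neqAle le_z (inj_eq (@fdist_inj u)) zv.
case: (ltnP (fdist u v) (fdist v u)) => [lt_d | ge_d].
  case/negP: (no_pole u); rewrite /pole uX; apply/subsetP=> w.
  have le_vk : fdist u v <= k by rewrite half_fdist lt_d orbT.
  rewrite defX !inE ltnS -orbA => /or3P[] /eqP -> //;
    last exact: leq_trans le_vk.
  by rewrite half_fdist eqxx.
right; split=> // w; rewrite defX !inE -orbA => /or3P[] /eqP ->;
  [by right | by left |].
by move: lt_z zu zv; cycle_lia.
Qed.

(** * Counting the mutual-visibility sets of size 3 *)

Lemma card_pole x : #|[set X | pole X x & #|X| == 3]| = 'C(k, 2).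
Proof.
have lt_kn : k < n by rewrite /k; have := ltn_ord x; lia.
set A := forward_arc x k.+1 :\ x.
have xA : x \in forward_arc x k.+1 by rewrite inE ltnS half_fdist eqxx.
have cardA : #|A| = k.
  by have := card_arc x lt_kn; rewrite (cardsD1 x) xA => -[].
rewrite -cardA -cards_draws.
have notinA (B : {set _}) : B \subset A -> x \notin B.
  by move=> sB; apply/negP=> /(subsetP sB); rewrite !inE eqxx.
rewrite -(card_in_imset (f := fun B => x |: B)); last first.
  move=> B B'; rewrite !inE => /andP[/notinA xB _] /andP[/notinA xB' _] eqB.
  by rewrite -(setU1K xB) eqB setU1K.
apply: eq_card => X; rewrite !inE; apply/idP/imsetP => [| [B]].
  case/andP=> /andP[xX sX] X3; exists (X :\ x); last by rewrite setD1K.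
  by rewrite inE setSD //=; move: X3; rewrite (cardsD1 x) xX.
rewrite inE => /andP[sB B2] ->; rewrite /pole setU11 subUset sub1set xA /=.
by rewrite (subset_trans sB (subsetDl _ _)) cardsU1 (eqP B2) notinA.
Qed.

(** The 3-sets that are not mutual-visibility sets are those with a pole, and
the sets with pole x and the sets with pole y are disjoint for x <> y. *)
Lemma card_mutual_visible3 :
  #|[set X | mutual_visibility_set C X & #|X| == 3]| + n * 'C(k, 2) = 'C(n, 3).
Proof.
pose F x := [set X | pole X x & #|X| == 3].
have disjF x y : x != y -> [disjoint F x & F y].
  move=> /eqP ne_xy; rewrite disjoint_subset; apply/subsetP=> X; rewrite !inE.
  move=> /andP[px _]; apply/negP=> /andP[py _].
  exact/ne_xy/(pole_uniq (X := X)).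
have -> : n * 'C(k, 2) = #|\bigcup_x F x|.
  rewrite -sum1_card partition_disjoint_bigcup //.
  under eq_bigr => x _ do rewrite sum1_card card_pole.
  by rewrite sum_nat_const card_ord.
have := card_draws 'I_n 3; rewrite card_ord => <-.
rewrite -[RHS](cardsID [set X | mutual_visibility_set C X]); congr (_ + _).
  by apply: eq_card => X; rewrite !inE andbC.
apply: eq_card => X; rewrite !inE; apply/bigcupP/andP => [[x _]|[nmv X3]].
  rewrite inE => /andP[px X3]; split=> //.
  by rewrite (@pole_not_mutual_visible X x) // (eqP X3).
suff /existsP[x px] : [exists x, pole X x] by exists x => //; rewrite inE px.
apply: contraR nmv; rewrite negb_exists => /forallP no_pole.
exact: mutual_visible_of_no_pole (eqP X3) no_pole.
Qed.

(** Closed form of 6 * r_mu for the cycle: it clears the denominators of the two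
binomial coefficients in [card_mutual_visible3]. *)
Definition six_r_mu := k * k.+1 * (if odd n then k.*2.+1 else k.*2 + 10).

Lemma card_mutual_visible3_closed : 2 < n ->
  6 * #|[set X | mutual_visibility_set C X & #|X| == 3]| = six_r_mu.
Proof.
move=> n_gt2; have := card_mutual_visible3; set N := #|_| => eqN.
have bin3 : 'C(n, 3) * 6 = n * (n.-1 * n.-2).
  by rewrite -[6]/(3`!) bin_ffact !ffactnS muln1.
have bin2 : 'C(k, 2) * 2 = k * k.-1.
  by rewrite -[2 in LHS]/(2`!) bin_ffact !ffactnS muln1.
have n_bin2 : n * 'C(k, 2) * 6 = 3 * (n * (k * k.-1)) by rewrite -bin2; lia.
have {eqN n_bin2 bin3 bin2} : 6 * N + 3 * (n * (k * k.-1)) = n * (n.-1 * n.-2).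
  by rewrite -n_bin2 -bin3 -eqN; lia.
rewrite /six_r_mu; case: ifP => odd_n.
  have [i [-> ->]] : exists i, k = i.+1 /\ n = i.*2.+3.
    by exists k.-1; rewrite /k; move: odd_n; lia.
  rewrite /= -!muln2; lia.
have [i [-> ->]] : exists i, k = i.+1 /\ n = i.*2.+4.
  by exists k.-1; rewrite /k; move: odd_n; lia.
rewrite /= -!muln2; lia.
Qed.

Lemma six_r_mu_gt0 : 2 < n -> 0 < six_r_mu.
Proof. by rewrite /six_r_mu !muln_gt0 /k; case: ifP; lia. Qed.

(** The count also yields the lower bound: some mutual-visibility set of size 3
exists since their number is positive. *)
Lemma mu_cycle : 2 < n -> mu C = 3.
Proof.
move=> n_gt2; apply/eqP; rewrite eqn_leq; apply/andP; split.
  by apply/bigmax_leqP=> X; apply: card_mutual_visible.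
have := six_r_mu_gt0 n_gt2; rewrite -card_mutual_visible3_closed // muln_gt0 /=.
case/card_gt0P=> X; rewrite inE => /andP[mvX /eqP <-].
exact: leq_bigmax_cond.
Qed.

Lemma r_mu_cycle : 2 < n -> 6 * r_mu C = six_r_mu.
Proof.
by move=> n_gt2; rewrite -card_mutual_visible3_closed // /r_mu mu_cycle.
Qed.

End Cycle.

(** * Comparison of two cycles *)

Theorem theorem10 (n1 n2 : nat) (hn1 : 3 <= n1) (hn12 : n1 < n2) :
  r_mu (cycle_graph n1) = r_mu (cycle_graph n2) <-> n1 = 6 /\ n2 = 7.
Proof.
have hn2 := ltn_trans hn1 hn12.
have six_inj a b : a = b <-> 6 * a = 6 * b by lia.
rewrite six_inj !r_mu_cycle // {six_inj hn2}.
split=> [|[-> ->] //].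
rewrite /six_r_mu -!muln2.
set j := n1.-1./2; set k := n2.-1./2.
have le_jk : j <= k by rewrite /j /k; lia.
have j_gt0 : 0 < j by rewrite /j; lia.
have lt_mul3 a b c d : a < b -> c < d -> a * a.+1 * c < b * b.+1 * d.
  by move=> lt_ab lt_cd; rewrite !ltn_mul.
case: (boolP (odd n1)) => odd1; case: (boolP (odd n2)) => odd2 eq6.
- have lt_jk : j < k by rewrite /j /k; lia.
  have := lt_mul3 j k (j * 2).+1 (k * 2).+1 lt_jk; rewrite eq6 ltnn; lia.
- have le_jjkk : j * j.+1 <= k * k.+1 by rewrite leq_mul.
  have : j * j.+1 * (j * 2).+1 < k * k.+1 * (k * 2 + 10).
    apply: leq_ltn_trans (leq_mul le_jjkk (leqnn _)) _.
    by rewrite ltn_pmul2l ?muln_gt0; lia.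
  by rewrite eq6 ltnn.
(* n1 = 2j + 2 and n2 = 2k + 1, hence k = j + 1 or k >= j + 2. *)
- case: (ltnP j.+1 k) => [lt_jk | le_kj].
    have : j * j.+1 * (j * 2 + 10) < j.+2 * j.+3 * (j.+2 * 2).+1 by nia.
    rewrite eq6 ltnNge; case/negP; apply: leq_mul; [exact: leq_mul | lia].
  have eq_k : k = j.+1 by rewrite /j /k in le_kj le_jk *; lia.
  rewrite eq_k in eq6; have eq_j : j = 2 by nia.
  by rewrite eq_j in eq_k; move: eq_k eq_j; rewrite /j /k; lia.
- have lt_jk : j < k by rewrite /j /k; lia.
  have := lt_mul3 j k (j * 2 + 10) (k * 2 + 10) lt_jk; rewrite eq6 ltnn; lia.
Qed.
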